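(* Let $\lambda\in\mathbb{C}$, let $r$ be a nonnegative integer, and let $S_\lambda$ be the complex unital associative algebra generated by $a$ and $a^\dagger$ subject to $aa^\dagger-a^\dagger a=\lambda a$ (with $r$ identified with $r\cdot 1$). Then for every integer $n\ge0$, \[ ((a^\dagger+r)a)^n=\sum_{k=0}^n {n+r \brack k+r}_{r,\lambda}(a^\dagger)^k a^n . \]
   Context: For $\lambda\in\mathbb{C}$, the $\lambda$-rising factorial is $\langle x\rangle_{0,\lambda}=1$, $\langle x\rangle_{n,\lambda}=x(x+\lambda)\cdots(x+(n-1)\lambda)$ for $n\ge1$. For a nonnegative integer $r$, the $\lambda$-$r$-Stirling numbers of the first kind ${n+r \brack k+r}_{r,\lambda}$ ($0\le k\le n$) are defined by $\langle x+r\rangle_{n,\lambda}=\sum_{k=0}^n {n+r \brack k+r}_{r,\lambda} x^k$. *)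

(* Defs.v *)
From HB Require Import structures.
From mathcomp Require Import all_boot all_order all_algebra.
From mathcomp Require Import boolp.
From mathcomp Require Import monalg.

Set Implicit Arguments.
Unset Strict Implicit.
Unset Printing Implicit Defensive.

Import GRing.Theory.

Local Open Scope ring_scope.
Local Open Scope quotient_scope.

Section TwoSidedIdeal.
Variables (A : nzRingType) (g : A).

(* The two-sided ideal A g A: all finite sums of u * g * v. *)
Definition twosided_ideal : {pred A} :=
  fun x => `[< exists s : seq (A * A), x = \sum_(p <- s) p.1 * g * p.2 >].

Lemma twosided_idealP x :
  reflect (exists s : seq (A * A), x = \sum_(p <- s) p.1 * g * p.2)
          (x \in twosided_ideal).
Proof. exact: asboolP. Qed.

Lemma twosided_ideal_gen : g \in twosided_ideal.
Proof.
by apply/twosided_idealP; exists [:: (1, 1)]; rewrite big_seq1 mul1r mulr1.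
Qed.

Lemma twosided_ideal_zmod_closed : zmod_closed twosided_ideal.
Proof.
split=> [|x y /twosided_idealP[s ->] /twosided_idealP[t ->]].
  by apply/twosided_idealP; exists [::]; rewrite big_nil.
apply/twosided_idealP; exists (s ++ [seq (- p.1, p.2) | p <- t]).
rewrite big_cat big_map /= -sumrN; congr (_ + _).
by apply: eq_bigr => p _; rewrite !mulNr.
Qed.

HB.instance Definition _ :=
  GRing.isZmodClosed.Build A twosided_ideal twosided_ideal_zmod_closed.

Lemma twosided_idealMl a x :
  x \in twosided_ideal -> a * x \in twosided_ideal.
Proof.
case/twosided_idealP=> s ->; apply/twosided_idealP.
exists [seq (a * p.1, p.2) | p <- s]; rewrite big_map mulr_sumr.
by apply: eq_bigr => p _; rewrite !mulrA.
Qed.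

Lemma twosided_idealMr a x :
  x \in twosided_ideal -> x * a \in twosided_ideal.
Proof.
case/twosided_idealP=> s ->; apply/twosided_idealP.
exists [seq (p.1, p.2 * a) | p <- s]; rewrite big_map mulr_suml.
by apply: eq_bigr => p _; rewrite !mulrA.
Qed.

End TwoSidedIdeal.

Lemma rmorph_relator (A : nzRingType) (B : comNzRingType)
    (f : {rmorphism A -> B}) (x y z : A) :
  f (x * y - y * x - z) = - f z.
Proof. by rewrite !rmorphB !rmorphM [f y * _]mulrC subrr sub0r. Qed.

Section MalgAlgebra.
Variables (M : monomType) (K : comNzRingType).
Implicit Types (c : K) (u v : {malg K[M]}).

Lemma malgC_comm c u : c%:MP * u = u * c%:MP.
Proof.
rewrite [u]monalgE mulr_sumr mulr_suml; apply: eq_bigr => k _.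
by rewrite !malgM_def !fgmulUU mul1m mulm1 mulrC.
Qed.

Lemma malg_scaleAr c u v : c *: (u * v) = u * (c *: v).
Proof. by rewrite -(mul_malgC c v) mulrA -malgC_comm -mulrA mul_malgC. Qed.

End MalgAlgebra.

Section ShiftAlgebra.
Variables (K : comNzRingType) (lam : K).

(* The free associative unital K-algebra on two generators: the monoid       *)
(* algebra of the free monoid on the two letters true (for a) and false (for *)
(* a^dagger).                                                                *)
Local Notation free_alg2 := {malg K[{fmonom bool}]}.

Definition gen_a : free_alg2 := << fmu true >>.
Definition gen_adag : free_alg2 := << fmu false >>.

Definition shift_relator : free_alg2 :=
  gen_a * gen_adag - gen_adag * gen_a - lam *: gen_a.

Definition shift_algebra : Type :=
  Quotient.quot (twosided_ideal shift_relator).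

HB.instance Definition _ := GRing.Zmodule.copy shift_algebra
  (Quotient.quot (twosided_ideal shift_relator)).

Local Notation I := (twosided_ideal shift_relator).
Let pi : free_alg2 -> shift_algebra := \pi_shift_algebra.

Let piP x y : reflect (pi x = pi y) (x - y \in I).
Proof. by rewrite Quotient.idealrBE; apply: eqP. Qed.

Let pi_surj (x : shift_algebra) : exists u, x = pi u.
Proof. by exists (repr x); rewrite /pi reprK. Qed.

Let repr_pi u : repr (pi u) - u \in I.
Proof. by apply/piP; rewrite /pi reprK. Qed.

Let pi0 : pi 0 = 0. Proof. by rewrite /pi piE. Qed.
Let piD u v : pi (u + v) = pi u + pi v. Proof. by rewrite /pi !piE. Qed.

Definition shift_one : shift_algebra := pi 1.
Definition shift_mul (x y : shift_algebra) : shift_algebra :=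
  pi (repr x * repr y).
Definition shift_scale (c : K) (x : shift_algebra) : shift_algebra :=
  pi (c *: repr x).

Let pi_mul u v : shift_mul (pi u) (pi v) = pi (u * v).
Proof.
apply/piP.
have -> : repr (pi u) * repr (pi v) - u * v =
    repr (pi u) * (repr (pi v) - v) + (repr (pi u) - u) * v.
  by rewrite mulrBr mulrBl addrA subrK.
by rewrite rpredD //; [apply: twosided_idealMl | apply: twosided_idealMr].
Qed.

Let pi_scale c u : shift_scale c (pi u) = pi (c *: u).
Proof.
apply/piP; rewrite -scalerBr -mul_malgC.
by apply: twosided_idealMl; apply: repr_pi.
Qed.

Let shift_mulA : associative shift_mul.
Proof.
move=> x y z; have [u ->] := pi_surj x; have [v ->] := pi_surj y.
by have [w ->] := pi_surj z; rewrite !pi_mul mulrA.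
Qed.

Let shift_mul1 : left_id shift_one shift_mul.
Proof. by move=> x; have [u ->] := pi_surj x; rewrite pi_mul mul1r. Qed.

Let shift_mulr1 : right_id shift_one shift_mul.
Proof. by move=> x; have [u ->] := pi_surj x; rewrite pi_mul mulr1. Qed.

Let shift_mulDl : left_distributive shift_mul +%R.
Proof.
move=> x y z; have [u ->] := pi_surj x; have [v ->] := pi_surj y.
by have [w ->] := pi_surj z; rewrite -piD !pi_mul mulrDl piD.
Qed.

Let shift_mulDr : right_distributive shift_mul +%R.
Proof.
move=> x y z; have [u ->] := pi_surj x; have [v ->] := pi_surj y.
by have [w ->] := pi_surj z; rewrite -piD !pi_mul mulrDr piD.
Qed.

(* The augmentation sending both generators to 0 kills the relator. *)
Let shift_one_neq0 : shift_one != 0.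
Proof.
rewrite -pi0; apply/negP => /eqP/piP; rewrite subr0 => /twosided_idealP[s].
pose aug : {rmorphism free_alg2 -> K} := mcoeff (mone : {fmonom bool}).
have aug_a : aug gen_a = 0.
  rewrite /aug /= mcoeffU1; case: eqP => // /(congr1 (@fdeg bool)).
  by rewrite fdegU fdeg1.
have aug_scale : aug (lam *: gen_a) = lam * aug gen_a := mcoeffZ _ _ _.
have aug_relator : aug shift_relator = 0.
  apply: etrans (rmorph_relator aug gen_a gen_adag (lam *: gen_a)) _.
  by rewrite aug_scale aug_a mulr0 oppr0.
move/(congr1 aug); rewrite rmorph1 rmorph_sum big1 => [/eqP|p _].
  by rewrite oner_eq0.
by rewrite [LHS]rmorphM rmorphM aug_relator mulr0 mul0r.
Qed.

HB.instance Definition _ := GRing.Zmodule_isNzRing.Build shift_algebra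
  shift_mulA shift_mul1 shift_mulr1 shift_mulDl shift_mulDr shift_one_neq0.

Let piM (u v : free_alg2) : pi u * pi v = pi (u * v). Proof. exact: pi_mul. Qed.

Let shift_scaleA a b x :
  shift_scale a (shift_scale b x) = shift_scale (a * b) x.
Proof. by have [u ->] := pi_surj x; rewrite !pi_scale scalerA. Qed.

Let shift_scale1 : left_id 1 shift_scale.
Proof. by move=> x; have [u ->] := pi_surj x; rewrite pi_scale scale1r. Qed.

Let shift_scaleDr : right_distributive shift_scale +%R.
Proof.
move=> c x y; have [u ->] := pi_surj x; have [v ->] := pi_surj y.
by rewrite -piD !pi_scale scalerDr piD.
Qed.

Let shift_scaleDl x : {morph shift_scale^~ x : a b / a + b}.
Proof.
by move=> a b; have [u ->] := pi_surj x; rewrite !pi_scale scalerDl piD.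
Qed.

HB.instance Definition _ := GRing.Zmodule_isLmodule.Build K shift_algebra
  shift_scaleA shift_scale1 shift_scaleDr shift_scaleDl.

Let piZ c (u : free_alg2) : c *: pi u = pi (c *: u). Proof. exact: pi_scale. Qed.

Let shift_scaleAl (c : K) (x y : shift_algebra) : c *: (x * y) = (c *: x) * y.
Proof.
have [u ->] := pi_surj x; have [v ->] := pi_surj y.
by rewrite piM !piZ piM scalerAl.
Qed.

HB.instance Definition _ :=
  GRing.Lmodule_isLalgebra.Build K shift_algebra shift_scaleAl.

Let shift_scaleAr (c : K) (x y : shift_algebra) : c *: (x * y) = x * (c *: y).
Proof.
have [u ->] := pi_surj x; have [v ->] := pi_surj y.
by rewrite piM !piZ piM malg_scaleAr.
Qed.

HB.instance Definition _ :=
  GRing.Lalgebra_isAlgebra.Build K shift_algebra shift_scaleAr.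

Definition shift_a : shift_algebra := pi gen_a.
Definition shift_adag : shift_algebra := pi gen_adag.

Lemma shift_relation :
  shift_a * shift_adag - shift_adag * shift_a = lam *: shift_a.
Proof.
apply/eqP; rewrite subr_eq piZ !piM -piD.
apply/eqP/piP; rewrite opprD addrA addrAC; exact: twosided_ideal_gen.
Qed.

End ShiftAlgebra.

(* <x>_(n, lam) = x (x + lam) ... (x + (n - 1) lam) *)
Definition lam_rising (K : comNzRingType) (lam x : K) (n : nat) : K :=
  \prod_(i < n) (x + lam *+ i).

(* rstirling1 lam r n k is the number written [n + r, k + r]_(r, lam): the   *)
(* coefficient of x^k in <x + r>_(n, lam); n and k are the indices before    *)
(* the shift by r.                                                           *)
Definition rstirling1 (K : comNzRingType) (lam : K) (r n k : nat) : K :=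
  (lam_rising lam%:P ('X + r%:R) n)`_k.

Lemma lam_rising_rstirling1 (K : comNzRingType) (lam : K) (r n : nat) (x : K) :
  lam_rising lam (x + r%:R) n = \sum_(k < n.+1) rstirling1 lam r n k * x ^+ k.
Proof.
set p := lam_rising lam%:P ('X + r%:R) n.
have -> : lam_rising lam (x + r%:R) n = p.[x].
  rewrite /p /lam_rising horner_prod; apply: eq_bigr => i _.
  by rewrite !hornerD hornerX !hornerMn !hornerC.
rewrite (@horner_coef_wide _ n.+1) //.
rewrite /p /lam_rising; elim: n {p} => [|n IH].
  by rewrite big_ord0 size_polyC oner_eq0.
rewrite big_ord_recr /= (leq_trans (size_polyMleq _ _)) //.
have -> : size ('X + r%:R + lam%:P *+ n) = 2.
  by rewrite -polyC_natr -polyCMn -addrA -polyCD size_XaddC.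
by rewrite addn2.
Qed.

(* Main.v *)
(** In any algebra where [a d - d a = lam a], one has [a^n d = (d + n lam) a^n].
    Moving [a^n] past the last factor [d + r] of [((d + r) a)^(n+1)] therefore
    produces the factor [d + r + n lam], so [((d + r) a)^n] is the rising
    factorial [<d + r>_(n, lam)] followed by [a^n]. *)
Require Import Defs.
From mathcomp Require Import all_boot all_order all_algebra.
From mathcomp Require Import reals complex.

Import GRing.Theory.

Local Open Scope ring_scope.

Lemma lam_risingS (K : comNzRingType) (lam x : K) (n : nat) :
  lam_rising lam x n.+1 = lam_rising lam x n * (x + lam *+ n).
Proof. by rewrite /lam_rising big_ord_recr. Qed.

Lemma size_lam_rising_poly (K : comNzRingType) (lam c : K) (n : nat) :
  (size (lam_rising lam%:P ('X + c%:P) n) <= n.+1)%N.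
Proof.
elim: n => [|n IHn]; first by rewrite /lam_rising big_ord0 size_polyC oner_eq0.
rewrite lam_risingS (leq_trans (size_polyMleq _ _)) //.
by rewrite -polyCMn -addrA -polyCD size_XaddC addn2.
Qed.

(** [horner_alg x] is a ring morphism, so it carries the monomial expansion of [p] to [A] term by
    term. *)
Lemma horner_alg_coef_wide (K : comNzRingType) (A : algType K) (x : A)
    (p : {poly K}) (n : nat) :
  (size p <= n)%N -> horner_alg x p = \sum_(k < n) p`_k *: x ^+ k.
Proof.
move=> le_p_n; rewrite -{1}(take_poly_id le_p_n) /take_poly poly_def rmorph_sum.
apply: eq_bigr => k _.
by rewrite -mul_polyC rmorphM rmorphXn /= horner_algC horner_algX mulr_algl.
Qed.

Section ShiftRelation.
Variables (K : comNzRingType) (A : algType K) (lam : K) (a d : A).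
Hypothesis a_d : a * d - d * a = lam *: a.

Lemma shift_expr_comm (n : nat) : a ^+ n * d = (d + (lam *+ n)%:A) * a ^+ n.
Proof.
elim: n => [|n IHn]; first by rewrite mulr0n scale0r addr0 mul1r mulr1.
(* The case of exponent 1; scalars being central, it also moves [a] past [d + (lam *+ n)%:A]. *)
have ad : a * d = (d + lam%:A) * a.
  by rewrite mulrDl mulr_algl -a_d addrC subrK.
rewrite {1}exprS -mulrA IHn mulrA mulrDr ad mulr_algr -[_ *: a]mulr_algl -mulrDl.
by rewrite -mulrA -exprS -addrA -scalerDl mulrS.
Qed.

(** [lam_rising] needs a commutative ring, so the product is formed in [{poly K}] and then evaluated
    at [d]. *)
Lemma shift_expr_rising (c : K) (n : nat) :
  ((d + c%:A) * a) ^+ n =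
  horner_alg d (lam_rising lam%:P ('X + c%:P) n) * a ^+ n.
Proof.
elim: n => [|n IHn]; first by rewrite /lam_rising big_ord0 rmorph1 mul1r.
rewrite exprSr IHn lam_risingS rmorphM -polyCMn !rmorphD /= horner_algX.
rewrite !horner_algC exprSr -!mulrA; congr (_ * _); rewrite !mulrA.
congr (_ * _).
(* What remains is to move [a ^+ n] past [d + c%:A]. *)
by rewrite mulrDr shift_expr_comm mulr_algr -[_ *: a ^+ n]mulr_algl -mulrDl addrAC.
Qed.

End ShiftRelation.

Theorem theorem2 (R : realType) (lam : R[i]) (r n : nat) :
  ((shift_adag lam + r%:R) * shift_a lam) ^+ n =
  \sum_(k < n.+1)
    rstirling1 lam r n k *: (shift_adag lam ^+ k * shift_a lam ^+ n).
Proof.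
(* Writing [r%:R] as a scalar multiple of 1 gives the case [c = r%:R]. *)
rewrite -(scaler_nat r 1) (shift_expr_rising _ _ _ _ _ (shift_relation lam)).
rewrite (horner_alg_coef_wide _ _ _ _ _ (size_lam_rising_poly _ _ _ _)).
rewrite mulr_suml; apply: eq_bigr => k _.
by rewrite -scalerAl /rstirling1 -polyC_natr.
Qed.
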